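(* Let $A$ be a semiprime associative algebra and let $x \in Q_s(A)$ be such that $xA + Ax \subseteq A$. Then $x$ is von Neumann regular (in $Q_s(A)$) if and only if $Q_s(A_x) \cong Q_s(A)_x$ under an isomorphism which is the identity on $A_x$.
   Context: All algebras are algebras over a fixed associative and commutative ring $\Phi$; associative algebras are not assumed to be unital. For a semiprime associative algebra $A$, $Q^l_{max}(A)$ denotes the maximal left quotient algebra of $A$, and $Q_s(A)$ denotes the Martindale symmetric algebra of quotients of $A$, i.e. the set of all $q \in Q^l_{max}(A)$ for which there is an essential (two-sided) ideal $I$ of $A$ with $Iq + qI \subseteq A$. An ideal is essential if its intersection with every nonzero ideal is nonzero. Local algebra at an element: for an algebra $B$ and an element $x$ of $B$, the local algebra $B_x$ is the $\Phi$-module $xBx$ with product $xax \cdot xbx = xaxbx$. The same definition is used for $A_x$ when $x \in Q_s(A)$ satisfies $xA + Ax \subseteq A$: $A_x$ is the $\Phi$-module $xAx$ with product $xax\cdot xbx = xaxbx$ ($a,b\in A$). Since $A\subseteq Q_s(A)$, one has $A_x \subseteq Q_s(A)_x$. An element $x$ of an associative algebra $B$ is von Neumann regular if $x = xyx$ for some $y \in B$. *)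

(* Defs.v *)
From HB Require Import structures.
From mathcomp Require Import all_boot all_order all_algebra.
From mathcomp Require Import boolp classical_sets.

Set Implicit Arguments.
Unset Strict Implicit.
Unset Printing Implicit Defensive.

Import GRing.Theory.
Local Open Scope classical_set_scope.
Local Open Scope ring_scope.

(* Associative, not necessarily unital algebras over a commutative ring Phi.
   The product is the one of the underlying semigroup, written (x * y)%g;
   sums, scalars and 0 are those of the underlying module. *)
HB.mixin Record isNuAlgebra (Phi : comPzRingType) A
    of GRing.Lmodule Phi A & Semigroup A := {
  nu_mulDl : forall x y z : A, ((x + y)%R * z)%g = (x * z)%g + (y * z)%g;
  nu_mulDr : forall x y z : A, (x * (y + z)%R)%g = (x * y)%g + (x * z)%g;
  nu_scaleAl : forall (c : Phi) (x y : A), c *: (x * y)%g = ((c *: x)%R * y)%g;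
  nu_scaleAr : forall (c : Phi) (x y : A), c *: (x * y)%g = (x * (c *: y)%R)%g
}.

#[short(type="nuAlgType")]
HB.structure Definition NuAlgebra (Phi : comPzRingType) :=
  {A of isNuAlgebra Phi A & GRing.Lmodule Phi A & Semigroup A}.

HB.structure Definition NuAlgMorphism (Phi : comPzRingType)
    (A B : nuAlgType Phi) :=
  {f of @GRing.Linear Phi A B *:%R f & @Multiplicative A B f}.

Notation "{ 'nuhom' A -> B }" := (NuAlgMorphism.type A%type B%type)
  (at level 0, A at level 98, B at level 99,
   format "{ 'nuhom'  A  ->  B }") : type_scope.

Section IdMorphism.
Variables (Phi : comPzRingType) (B : nuAlgType Phi).

HB.instance Definition _ := GRing.Linear.on (idfun : B -> B).
HB.instance Definition _ := Multiplicative.on (idfun : B -> B).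

Definition nu_id : {nuhom B -> B} := idfun.

End IdMorphism.

Section Ideals.
Variables (Phi : comPzRingType) (A : nuAlgType Phi).
Implicit Types I J : set A.

Definition nu_ideal I : Prop :=
  [/\ I 0,
      forall a b, I a -> I b -> I (a + b),
      forall (c : Phi) a, I a -> I (c *: a)
    & forall a b, I b -> I (a * b)%g /\ I (b * a)%g].

Definition essential_ideal I : Prop :=
  nu_ideal I /\ forall J, nu_ideal J -> J <> [set 0] -> I `&` J <> [set 0].

Definition semiprime : Prop :=
  forall I, nu_ideal I -> (forall a b, I a -> I b -> (a * b)%g = 0) ->
    I = [set 0].

Definition vn_regular (x : A) : Prop := exists y, x = (x * y * x)%g.

End Ideals.

(* An algebra containing A is given by an injective morphism out of A; the
   subset "A" of the larger algebra is then the range of that morphism. *)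

(* Utumi's condition: for all p, q in B with p <> 0 there is a in A with
   ap <> 0 and aq in A. *)
Definition left_quotient_alg (Phi : comPzRingType) (A B : nuAlgType Phi)
    (i : {nuhom A -> B}) : Prop :=
  injective i /\
  forall p q : B, p <> 0 ->
    exists a : A, (i a * p)%g <> 0 /\ range i (i a * q)%g.

Definition max_left_quotient_alg (Phi : comPzRingType) (A Q : nuAlgType Phi)
    (i : {nuhom A -> Q}) : Prop :=
  left_quotient_alg i /\
  forall (B : nuAlgType Phi) (k : {nuhom A -> B}), left_quotient_alg k ->
    exists h : {nuhom B -> Q}, injective h /\ forall a, h (k a) = i a.

(* f : A -> S presents S as Q_s(A): S is identified by g with the subalgebra of
   all q in Q^l_max(A) such that Iq + qI is contained in A for some essential
   ideal I of A. *)
Definition martindale_symmetric_alg (Phi : comPzRingType) (A S : nuAlgType Phi)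
    (f : {nuhom A -> S}) : Prop :=
  exists (Q : nuAlgType Phi) (i : {nuhom A -> Q}) (g : {nuhom S -> Q}),
    [/\ max_left_quotient_alg i,
        injective g,
        forall a, g (f a) = i a
      & range g = [set q | exists2 I : set A, essential_ideal I &
          forall a, I a -> range i (i a * q)%g /\ range i (q * i a)%g]].

(* xA + Ax is contained in A, for x in B and A mapped to B by f. *)
Definition absorbed (Phi : comPzRingType) (A B : nuAlgType Phi)
    (f : {nuhom A -> B}) (x : B) : Prop :=
  forall a : A, range f (x * f a)%g /\ range f (f a * x)%g.

Lemma absorbed_id (Phi : comPzRingType) (B : nuAlgType Phi) (x : B) :
  absorbed (nu_id B) x.
Proof. by move=> a; split; eexists. Qed.

Section LocalAlgebra.
Variables (Phi : comPzRingType) (A B : nuAlgType Phi).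
Variables (f : {nuhom A -> B}) (x : B).

Definition local_pred : {pred B} :=
  fun y => `[< exists a : A, y = (x * f a * x)%g >].

Lemma local_predP y :
  reflect (exists a : A, y = (x * f a * x)%g) (y \in local_pred).
Proof. exact: asboolP. Qed.

Lemma local_submod_closed : submod_closed local_pred.
Proof.
split=> [|c _ _ /local_predP[a ->] /local_predP[b ->]]; apply/local_predP.
  exists 0; rewrite -[in RHS](scale0r (0 : A)) linearZ /=.
  by rewrite -nu_scaleAr -nu_scaleAl scale0r.
exists (c *: a + b).
by rewrite linearP /= nu_mulDr nu_mulDl -nu_scaleAr -nu_scaleAl.
Qed.

HB.instance Definition _ :=
  GRing.isSubmodClosed.Build Phi B local_pred local_submod_closed.

(* The local algebra at x: the Phi-module xAx inside B with the product
   xax . xbx = xaxbx (see local_mulE). Taking f to be the identity of B gives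
   B_x, taking f to be the embedding of A gives A_x. *)
Record local_alg (fx : absorbed f x) :=
  LocalAlg { local_val : B; local_valP : local_val \in local_pred }.

Variable fx : absorbed f x.

HB.instance Definition _ := [isSub for @local_val fx].
HB.instance Definition _ := [Choice of local_alg fx by <:].
HB.instance Definition _ :=
  [SubChoice_isSubLmodule of local_alg fx by <:].

Lemma local_valD : {morph (@local_val fx) : u v / u + v}.
Proof. exact: (raddfD (val : local_alg fx -> B)). Qed.

Lemma local_valZ (k : Phi) : {morph (@local_val fx) : u / k *: u}.
Proof. exact: (linearZ_LR (val : local_alg fx -> B)). Qed.

Definition local_coef (u : local_alg fx) : A :=
  projT1 (cid (local_predP _ (local_valP u))).

Lemma local_coefK (u : local_alg fx) : local_val u = (x * f (local_coef u) * x)%g.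
Proof. exact: projT2 (cid (local_predP _ (local_valP u))). Qed.

Fact local_mul_subproof (u v : local_alg fx) :
  (x * f (local_coef u) * x * f (local_coef v) * x)%g \in local_pred.
Proof.
have [[c _ xvE] _] := fx (local_coef v).
apply/local_predP; exists (local_coef u * c)%g.
by rewrite gmulfM /= xvE !mulgA.
Qed.

Definition local_mul (u v : local_alg fx) : local_alg fx :=
  LocalAlg fx (local_mul_subproof u v).

Lemma local_mull (u v : local_alg fx) y : local_val u = (y * x)%g ->
  local_val (local_mul u v) = (y * local_val v)%g.
Proof. by move=> uE; rewrite /= -(local_coefK u) uE [in RHS](local_coefK v) !mulgA. Qed.

Lemma local_mulr (u v : local_alg fx) y : local_val v = (x * y)%g ->
  local_val (local_mul u v) = (local_val u * y)%g.
Proof.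
move=> vE; rewrite (local_mull _ (local_coefK u)) vE [in RHS]local_coefK.
by rewrite !mulgA.
Qed.

Lemma local_valE (u : local_alg fx) : exists a : A, local_val u = (x * f a * x)%g.
Proof. by exists (local_coef u); exact: local_coefK. Qed.

Fact local_mulA : associative local_mul.
Proof.
move=> u v w; apply: val_inj.
change (local_val (local_mul u (local_mul v w)) =
        local_val (local_mul (local_mul u v) w)).
have [a uE] := local_valE u; have [c wE] := local_valE w.
have wE' : local_val w = (x * (f c * x))%g by rewrite wE mulgA.
rewrite (local_mull _ uE) (local_mulr _ wE') (local_mulr _ wE').
by rewrite (local_mull _ uE) mulgA.
Qed.

HB.instance Definition _ := isSemigroup.Build (local_alg fx) local_mulA.

Fact local_mulDl (u v w : local_alg fx) :
  ((u + v)%R * w)%g = (u * w)%g + (v * w)%g.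
Proof.
apply: val_inj; have [c wE] := local_valE w.
have {}wE : local_val w = (x * (f c * x))%g by rewrite wE mulgA.
rewrite [RHS]local_valD [LHS](local_mulr _ wE) local_valD nu_mulDl.
by congr (_ + _); rewrite [RHS](local_mulr _ wE).
Qed.

Fact local_mulDr (u v w : local_alg fx) :
  (u * (v + w)%R)%g = (u * v)%g + (u * w)%g.
Proof.
apply: val_inj; have [a uE] := local_valE u.
rewrite [RHS]local_valD [LHS](local_mull _ uE) local_valD nu_mulDr.
by congr (_ + _); rewrite [RHS](local_mull _ uE).
Qed.

Fact local_scaleAl (k : Phi) (u v : local_alg fx) :
  k *: (u * v)%g = ((k *: u)%R * v)%g.
Proof.
apply: val_inj; have [c vE] := local_valE v.
have {}vE : local_val v = (x * (f c * x))%g by rewrite vE mulgA.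
rewrite [LHS]local_valZ [RHS](local_mulr _ vE) local_valZ -nu_scaleAl.
by rewrite [in LHS](local_mulr _ vE).
Qed.

Fact local_scaleAr (k : Phi) (u v : local_alg fx) :
  k *: (u * v)%g = (u * (k *: v)%R)%g.
Proof.
apply: val_inj; have [a uE] := local_valE u.
rewrite [LHS]local_valZ [RHS](local_mull _ uE) local_valZ -nu_scaleAr.
by rewrite [in LHS](local_mull _ uE).
Qed.

HB.instance Definition _ := isNuAlgebra.Build Phi (local_alg fx)
  local_mulDl local_mulDr local_scaleAl local_scaleAr.

Fact local_elt_subproof a : (x * f a * x)%g \in local_pred.
Proof. by apply/local_predP; exists a. Qed.

Definition local_elt (a : A) : local_alg fx :=
  LocalAlg fx (local_elt_subproof a).

Lemma local_mulE a b :
  local_val (local_elt a * local_elt b)%g = (x * f a * x * f b * x)%g.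
Proof.
have aE : local_val (local_elt a) = (x * f a * x)%g by [].
by rewrite [LHS](local_mull _ aE) /= !mulgA.
Qed.

End LocalAlgebra.

(* Main.v *)
Require Import Defs.
From HB Require Import structures.
From mathcomp Require Import all_boot all_order all_algebra generic_quotient.
From mathcomp Require Import boolp classical_sets.

(** Regularity of x makes the local algebra at x as large as it can be.

    Whatever x is, S_x = xSx is a left quotient algebra of A_x = xAx, and each
    of its elements is carried into A_x by an essential ideal of A_x: an
    essential ideal of A that absorbs the middle factor of xsx supplies one.
    Hence S_x embeds in T = Q_s(A_x) over A_x ([local_left_quotient],
    [local_essential], [martindale_embed]), and the theorem is about what the
    inverse of this embedding would need.

    If T is S_x, then S_x is unital because a symmetric algebra of quotients is
    ([martindale_left_unit]). Its unit xsx satisfies xsxtx = xtx for all t, so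
    (xsx - x)Sx = 0, and nondegeneracy of S gives x = xsx.

    Conversely let x = xyx, so that the product of S_x becomes u y v. Then S_x is
    all of T: for q in T, the element of S that has to correspond to q is
    s = y q y, read as a partially defined two-sided multiplier of A. Taking an
    essential ideal I of A_x with Iq + qI inside A_x, its right action
    k |-> ks = m is pinned down by m = mxy and m v = k y (qv) for v in I
    ([right_value]). The elements of A on which both actions take values in A
    contain an essential ideal ([extension_domain_essential]), so s exists in S
    ([martindale_extend]); then xsx corresponds to q ([regular_extension]).

    Producing elements of Q_s(A) from partial multipliers requires a concrete
    maximal left quotient algebra: the one used is the algebra of germs of left
    A-linear maps on dense left ideals, which maximality of Q embeds in Q. *)

Set Implicit Arguments.
Unset Strict Implicit.
Unset Printing Implicit Defensive.

Import GRing.Theory.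
Local Open Scope classical_set_scope.
Local Open Scope ring_scope.
Local Open Scope quotient_scope.

Local Notation "a ** b" := (a * b)%g (at level 40, left associativity).

(** * Nonunital algebras, ideals and nondegeneracy *)

Section NuAlgebraTheory.
Variables (Phi : comPzRingType) (A : nuAlgType Phi).
Implicit Types (a b : A) (I J : set A).

Lemma nu_mul0l a : 0 ** a = 0.
Proof. by apply: (addIr (0 ** a)); rewrite -nu_mulDl !add0r. Qed.

Lemma nu_mul0r a : a ** 0 = 0.
Proof. by apply: (addIr (a ** 0)); rewrite -nu_mulDr !add0r. Qed.

Lemma nu_mulNl a b : (- a) ** b = - (a ** b).
Proof. by apply: (addIr (a ** b)); rewrite -nu_mulDl !addNr nu_mul0l. Qed.

Lemma nu_mulNr a b : a ** (- b) = - (a ** b).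
Proof. by apply: (addIr (a ** b)); rewrite -nu_mulDr !addNr nu_mul0r. Qed.

Lemma nu_mulBl a b c : (a - b) ** c = a ** c - b ** c.
Proof. by rewrite nu_mulDl nu_mulNl. Qed.

Lemma nu_mulBr a b c : a ** (b - c) = a ** b - a ** c.
Proof. by rewrite nu_mulDr nu_mulNr. Qed.

Lemma neq_set0P I : nu_ideal I -> I <> [set 0] <-> exists2 a, I a & a <> 0.
Proof.
move=> [I0 _ _ _]; split=> [In0|[a Ia an0] IE]; last by rewrite IE in Ia.
apply: contrapT => no; apply: In0; apply/seteqP; split=> [a Ia|_ ->] //=.
by apply: contrapT => an0; apply: no; exists a.
Qed.

Lemma nu_idealI I J : nu_ideal I -> nu_ideal J -> nu_ideal (I `&` J).
Proof.
move=> [I0 ID IZ IM] [J0 JD JZ JM]; split=> //.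
- by move=> a b [? ?] [? ?]; split; [apply: ID | apply: JD].
- by move=> c a [? ?]; split; [apply: IZ | apply: JZ].
by move=> a b [/IM-/(_ a)[? ?] /JM-/(_ a)[? ?]].
Qed.

Lemma essential_meet I J : essential_ideal I -> nu_ideal J ->
  (exists2 a, J a & a <> 0) -> exists2 a, (I `&` J) a & a <> 0.
Proof.
move=> [idI essI] idJ /(neq_set0P idJ)/(essI _ idJ).
by move=> /(neq_set0P (nu_idealI idI idJ)).
Qed.

Lemma essentialP I : nu_ideal I ->
  (forall J a, nu_ideal J -> J a -> a <> 0 -> exists2 b, (I `&` J) b & b <> 0) ->
  essential_ideal I.
Proof.
move=> idI meet; split=> // J idJ /(neq_set0P idJ)[a Ja an0].
by apply/(neq_set0P (nu_idealI idI idJ)); apply: meet an0.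
Qed.

Lemma essential_setT : essential_ideal (@setT A).
Proof. by apply: essentialP => // J a idJ Ja an0; exists a. Qed.

Lemma essential_idealI I J :
  essential_ideal I -> essential_ideal J -> essential_ideal (I `&` J).
Proof.
move=> eI eJ; apply: essentialP => [|K a idK Ka an0].
  by apply: nu_idealI; [case: eI | case: eJ].
rewrite -setIA; apply: essential_meet => //; first by apply: nu_idealI; case: eJ.
by apply: essential_meet => //; exists a.
Qed.

Definition nondegenerate := forall a, (forall b, a ** b ** a = 0) -> a = 0.

(** Annihilators are used in place of the ideal generated by a. The left
    annihilator V of Aa is an ideal; its right annihilator W is one too, so
    V and W meet in an ideal of square zero. If aAa = 0 then Aa lies in both. *)
Lemma semiprime_nondegenerate : semiprime A -> nondegenerate.
Proof.
move=> spA.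
have rann0 z : (forall b, b ** z = 0) -> z = 0.
  move=> Az; pose R := [set z : A | forall b, b ** z = 0].
  suff RE : R = [set 0] by have : R z by []; rewrite RE.
  apply: spA => [|u v _ /(_ u) //]; split=> /=.
  - by move=> b; rewrite nu_mul0r.
  - by move=> u v uR vR b; rewrite nu_mulDr uR vR addr0.
  - by move=> c u uR b; rewrite -nu_scaleAr uR scaler0.
  by move=> u v vR; split=> b; rewrite mulgA ?vR // nu_mul0l.
move=> a aAa; pose V := [set z | forall b, z ** b ** a = 0].
pose W := [set w | forall z, V z -> z ** w = 0].
have idV : nu_ideal V.
  split=> /=.
  - by move=> b; rewrite !nu_mul0l.
  - by move=> u v uV vV b; rewrite !nu_mulDl uV vV addr0.
  - by move=> c u uV b; rewrite -!nu_scaleAl uV scaler0.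
  move=> u v vV; split=> b; last by rewrite -(mulgA v) vV.
  by rewrite -!mulgA (mulgA v) vV nu_mul0r.
have idW : nu_ideal W.
  split=> /=.
  - by move=> b _; rewrite !nu_mul0r.
  - by move=> u v uW vW b Vb; rewrite nu_mulDr uW ?vW ?addr0.
  - by move=> c u uW b Vb; rewrite -nu_scaleAr uW ?scaler0.
  move=> u v vW; split=> b Vb; rewrite mulgA; last by rewrite vW ?nu_mul0l.
  by apply: vW; case: idV => _ _ _ /(_ u _ Vb)[].
have VW0 : V `&` W = [set 0].
  by apply: spA; [exact: nu_idealI | move=> u v [Vu _] [_ Wv]; exact: Wv].
apply: rann0 => b; suff : (V `&` W) (b ** a) by rewrite VW0.
split; first by case: idV => _ _ _ /(_ b a)[].
by move=> z Vz; rewrite mulgA.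
Qed.

Hypothesis ndA : nondegenerate.

Lemma essential_rann0 I z : essential_ideal I -> (forall a, I a -> a ** z = 0) ->
  z = 0.
Proof.
move=> eI Iz; have [[I0 ID IZ IM] _] := eI.
pose R := [set z : A | forall a, I a -> a ** z = 0].
have idR : nu_ideal R.
  split=> /=.
  - by move=> b _; rewrite nu_mul0r.
  - by move=> u v uR vR b Ib; rewrite nu_mulDr uR ?vR ?addr0.
  - by move=> c u uR b Ib; rewrite -nu_scaleAr uR ?scaler0.
  move=> u v vR; split=> b Ib; rewrite mulgA; last by rewrite vR ?nu_mul0l.
  by apply: vR; case: (IM u b Ib).
apply: contrapT => zn0.
have [|w [Iw Rw] []] := essential_meet eI idR; first by exists z.
by apply: ndA => b; apply: Rw; case: (IM b w Iw).
Qed.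

Lemma essential_lann0 I z : essential_ideal I -> (forall a, I a -> z ** a = 0) ->
  z = 0.
Proof.
move=> eI zI; have [[I0 ID IZ IM] _] := eI.
pose R := [set z : A | forall a, I a -> z ** a = 0].
have idR : nu_ideal R.
  split=> /=.
  - by move=> b _; rewrite nu_mul0l.
  - by move=> u v uR vR b Ib; rewrite nu_mulDl uR ?vR ?addr0.
  - by move=> c u uR b Ib; rewrite -nu_scaleAl uR ?scaler0.
  move=> u v vR; split=> b Ib; rewrite -mulgA; first by rewrite vR ?nu_mul0r.
  by apply: vR; case: (IM u b Ib).
apply: contrapT => zn0.
have [|w [Iw Rw] []] := essential_meet eI idR; first by exists z.
by apply: ndA => b; rewrite -mulgA; apply: Rw; case: (IM b w Iw).
Qed.

Lemma essential_nondegenerate I z : essential_ideal I ->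
  (forall a, I a -> z ** a ** z = 0) -> z = 0.
Proof.
move=> eI zIz; have [[I0 ID IZ IM] _] := eI.
apply: (essential_rann0 eI) => a Ia; apply: ndA => b.
rewrite -(mulgA a z b) -(mulgA a) (mulgA (z ** b)) -(mulgA z b a).
by rewrite zIz ?nu_mul0r //; case: (IM b a Ia).
Qed.

End NuAlgebraTheory.

(** * Morphisms of nonunital algebras *)

(** Packages as a morphism a function that is only known through a choice
    principle. *)
Lemma nuhom_ex (Phi : comPzRingType) (A B : nuAlgType Phi) (h : A -> B) :
  linear h -> {morph h : a b / a ** b} -> exists F : {nuhom A -> B}, F =1 h.
Proof.
move=> lin_h mul_h.
pose F1 := GRing.isLinear.Build Phi A B *:%R h lin_h.
pose F2 := isMultiplicative.Build A B h mul_h.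
pose F : {nuhom A -> B} := HB.pack h F1 F2.
by exists F.
Qed.

Section NuHomTheory.
Variables (Phi : comPzRingType) (A B : nuAlgType Phi) (f : {nuhom A -> B}).

Lemma nuhomM a b : f (a ** b) = f a ** f b.
Proof. by rewrite gmulfM. Qed.

Lemma nuhom0 : f 0 = 0.
Proof. exact: (raddf0 f). Qed.

Lemma nuhomB a b : f (a - b) = f a - f b.
Proof. exact: (raddfB f). Qed.

Lemma nuhomD a b : f (a + b) = f a + f b.
Proof. exact: (raddfD f). Qed.

Lemma nuhomZ (c : Phi) a : f (c *: a) = c *: f a.
Proof. exact: (linearZ_LR f). Qed.

End NuHomTheory.

(** * The algebra of germs of partial left multipliers *)

Section LeftQuotients.
Variables (Phi : comPzRingType) (A : nuAlgType Phi).

Definition right_faithful := forall p : A, p <> 0 -> exists a, a ** p <> 0.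

Definition left_ideal (D : set A) : Prop :=
  [/\ D 0,
      forall a b, D a -> D b -> D (a + b),
      forall (c : Phi) a, D a -> D (c *: a)
    & forall a b, D b -> D (a ** b)].

(** This is the condition of Utumi for left quotients, with the ideal D in the role
    of A. It passes to preimages under partial left linear maps, which is what makes
    composition of such maps possible. *)
Definition dense (D : set A) : Prop :=
  forall p q, p <> 0 -> exists a, a ** p <> 0 /\ D (a ** q).

(** A partially defined right multiplication a |-> aq, the function being
    meaningful on its domain only. *)
Record partial_map := PartialMap {
  pdom : set A;
  pfun : A -> A;
  pdom_ideal : left_ideal pdom;
  pdom_dense : dense pdom;
  pfunD : forall a b, pdom a -> pdom b -> pfun (a + b) = pfun a + pfun b;
  pfunZ : forall (c : Phi) a, pdom a -> pfun (c *: a) = c *: pfun a;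
  pfunM : forall a b, pdom b -> pfun (a ** b) = a ** pfun b
}.

HB.instance Definition _ := gen_eqMixin partial_map.
HB.instance Definition _ := gen_choiceMixin partial_map.

Definition agree (r s : partial_map) :=
  `[< forall a, pdom r a -> pdom s a -> pfun r a = pfun s a >].

Lemma agreeP r s :
  reflect (forall a, pdom r a -> pdom s a -> pfun r a = pfun s a) (agree r s).
Proof. exact: asboolP. Qed.

(** Agreement on the whole common domain is detected on any dense subset: if r and s
    differ at b, some a keeps the difference nonzero and moves b into D. This
    is what makes agreement transitive. *)
Lemma dense_agree (D : set A) r s : dense D ->
  (forall a, D a -> [/\ pdom r a, pdom s a & pfun r a = pfun s a]) -> agree r s.
Proof.
move=> dD Drs; apply/agreeP => b rb sb; apply: contrapT => rsb.
have /(dD _ b)[a []] : pfun r b - pfun s b <> 0.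
  by move/subr0_eq.
rewrite nu_mulBr -!pfunM // => ne /Drs[_ _ E].
by apply: ne; rewrite E subrr.
Qed.

Lemma denseI D E : left_ideal D -> dense D -> dense E -> dense (D `&` E).
Proof.
move=> [_ _ _ DM] dD dE p q /(dD _ q)[a [/(dE _ (a ** q))[b [bap Eb]] Da]].
exists (b ** a); rewrite -!mulgA; split; first by rewrite mulgA -mulgA.
by split=> //; apply: DM.
Qed.

Lemma left_idealI D E : left_ideal D -> left_ideal E -> left_ideal (D `&` E).
Proof.
move=> [D0 DD DZ DM] [E0 ED EZ EM]; split=> //.
- by move=> a b [? ?] [? ?]; split; [apply: DD | apply: ED].
- by move=> c a [? ?]; split; [apply: DZ | apply: EZ].
by move=> a b [? ?]; split; [apply: DM | apply: EM].
Qed.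

Fact agree_refl : reflexive agree.
Proof. by move=> r; apply/agreeP. Qed.

Fact agree_sym : symmetric agree.
Proof. by move=> r s; apply/agreeP/agreeP => rs a ? ?; rewrite rs. Qed.

Fact agree_trans : transitive agree.
Proof.
move=> s r t /agreeP rs /agreeP st.
apply: (dense_agree (D := pdom r `&` (pdom s `&` pdom t))).
  apply: denseI (pdom_dense _) _; first exact: pdom_ideal.
  by apply: denseI (pdom_dense _) (pdom_dense _); exact: pdom_ideal.
by move=> a [ra [sa ta]]; split=> //; rewrite rs ?st.
Qed.

Canonical agree_equiv := EquivRel agree agree_refl agree_sym agree_trans.

(** The germ type carries the faithfulness of A because its zero and the image of
    A are defined on all of A, which is dense only then. *)
Definition germ_alg (_ : right_faithful) := {eq_quot agree}.

Variable rfA : right_faithful.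
Local Notation germ := (germ_alg rfA).
HB.instance Definition _ := Choice.on germ.
HB.instance Definition _ := EqQuotient.on germ.

Lemma germP r s : \pi_germ r = \pi_germ s <->
  (forall a, pdom r a -> pdom s a -> pfun r a = pfun s a).
Proof.
split=> [/eqmodP/agreeP //|rs].
by apply/eqmodP/agreeP.
Qed.

Lemma dense_setT : dense setT.
Proof. by move=> p q /rfA[a ap]; exists a. Qed.

Lemma left_ideal_setT : left_ideal setT.
Proof. by []. Qed.

Definition pmap0 : partial_map.
Proof.
apply: (@PartialMap setT (fun=> 0) left_ideal_setT dense_setT) => *.
- by rewrite addr0.
- by rewrite scaler0.
by rewrite nu_mul0r.
Defined.

Definition pmapN (r : partial_map) : partial_map.
Proof.
apply: (@PartialMap (pdom r) (fun a => - pfun r a) (pdom_ideal r) (pdom_dense r)).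
- by move=> *; rewrite pfunD // opprD.
- by move=> *; rewrite pfunZ // scalerN.
by move=> *; rewrite pfunM // nu_mulNr.
Defined.

Definition pmapZ (c : Phi) (r : partial_map) : partial_map.
Proof.
apply: (@PartialMap (pdom r) (fun a => c *: pfun r a) (pdom_ideal r) (pdom_dense r)).
- by move=> *; rewrite pfunD // scalerDr.
- by move=> *; rewrite pfunZ // !scalerA mulrC.
by move=> *; rewrite pfunM // nu_scaleAr.
Defined.

Definition pmapD (r s : partial_map) : partial_map.
Proof.
apply: (@PartialMap (pdom r `&` pdom s) (fun a => pfun r a + pfun s a)
  (left_idealI (pdom_ideal r) (pdom_ideal s))
  (denseI (pdom_ideal r) (pdom_dense r) (pdom_dense s))).
- by move=> a b [? ?] [? ?]; rewrite !pfunD // addrACA.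
- by move=> c a [? ?]; rewrite !pfunZ // scalerDr.
by move=> a b [? ?]; rewrite !pfunM // nu_mulDr.
Defined.

(** Right multiplications compose in the opposite order: a(uv) = (au)v. *)
Definition pmapM (r s : partial_map) : partial_map.
Proof.
apply: (@PartialMap [set a | pdom r a /\ pdom s (pfun r a)]
  (fun a => pfun s (pfun r a))).
- have [r0 rD rZ rM] := pdom_ideal r; have [s0 sD sZ sM] := pdom_ideal s.
  split=> /=.
  + by split=> //; rewrite -[0](scale0r (0 : A)) pfunZ // scale0r.
  + move=> a b [? ?] [? ?]; split; first exact: rD.
    by rewrite pfunD //; exact: sD.
  + by move=> c a [? ?]; split; rewrite ?pfunZ //; [exact: rZ | exact: sZ].
  by move=> a b [? ?]; split; rewrite ?pfunM //; [exact: rM | exact: sM].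
- move=> p q /(pdom_dense r q)[a [ap ra]].
  have [b [bap sb]] := pdom_dense s (pfun r (a ** q)) ap.
  exists (b ** a); rewrite -!mulgA; split; first by rewrite mulgA -mulgA.
  by have [_ _ _ rM] := pdom_ideal r; split; [exact: rM | rewrite pfunM].
- by move=> a b [? ?] [? ?]; rewrite !pfunD.
- by move=> c a [? ?]; rewrite !pfunZ.
by move=> a b [? ?]; rewrite !pfunM.
Defined.

Definition pmap_of (a : A) : partial_map.
Proof.
apply: (@PartialMap setT (fun b => b ** a) left_ideal_setT dense_setT) => *.
- by rewrite nu_mulDl.
- by rewrite nu_scaleAl.
by rewrite mulgA.
Defined.

(** The operations are locked, since otherwise the rules [pi_N] to [pi_M] would
    match an unfolded operation as the class of an explicit partial map. *)
Definition germ0 : germ := \pi_germ pmap0.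
Definition germN (u : germ) : germ := locked (\pi_germ (pmapN (repr u))).
Definition germZ (c : Phi) (u : germ) : germ := locked (\pi_germ (pmapZ c (repr u))).
Definition germD (u v : germ) : germ := locked (\pi_germ (pmapD (repr u) (repr v))).
Definition germM (u v : germ) : germ := locked (\pi_germ (pmapM (repr u) (repr v))).

Lemma repr_pi r a : pdom (repr (\pi_germ r)) a -> pdom r a ->
  pfun (repr (\pi_germ r)) a = pfun r a.
Proof. by apply: (germP _ _).1; rewrite reprK. Qed.

Lemma pi_N r : germN (\pi_germ r) = \pi_germ (pmapN r).
Proof. by rewrite /germN -lock; apply/germP => a /= ? ?; rewrite repr_pi. Qed.

Lemma pi_Z c r : germZ c (\pi_germ r) = \pi_germ (pmapZ c r).
Proof. by rewrite /germZ -lock; apply/germP => a /= ? ?; rewrite repr_pi. Qed.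

Lemma pi_D r s : germD (\pi_germ r) (\pi_germ s) = \pi_germ (pmapD r s).
Proof. by rewrite /germD -lock; apply/germP => a /= [? ?] [? ?]; rewrite !repr_pi. Qed.

Lemma pi_M r s : germM (\pi_germ r) (\pi_germ s) = \pi_germ (pmapM r s).
Proof.
rewrite /germM -lock; apply/germP => a /= [? rs] [? ?]; move: rs; rewrite repr_pi // => ?.
by rewrite repr_pi.
Qed.

Definition piE := (pi_N, pi_Z, pi_D, pi_M).

Fact germ_addA : associative germD.
Proof.
elim/quotW=> r; elim/quotW=> s; elim/quotW=> t; rewrite !piE.
by apply/germP => a * /=; rewrite addrA.
Qed.

Fact germ_addC : commutative germD.
Proof.
elim/quotW=> r; elim/quotW=> s; rewrite !piE.
by apply/germP => a * /=; rewrite addrC.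
Qed.

Fact germ_add0 : left_id germ0 germD.
Proof. by elim/quotW=> r; rewrite piE; apply/germP => a * /=; rewrite add0r. Qed.

Fact germ_addN : left_inverse germ0 germN germD.
Proof. by elim/quotW=> r; rewrite !piE; apply/germP => a * /=; rewrite addNr. Qed.

HB.instance Definition _ :=
  GRing.isZmodule.Build germ germ_addA germ_addC germ_add0 germ_addN.

Lemma pi_add r s : \pi_germ r + \pi_germ s = \pi_germ (pmapD r s).
Proof. exact: pi_D. Qed.

Fact germ_scaleA c d (u : germ) : germZ c (germZ d u) = germZ (c * d) u.
Proof. by elim/quotW: u => r; rewrite !piE; apply/germP => a * /=; rewrite scalerA. Qed.

Fact germ_scale1 : left_id 1 germZ.
Proof. by elim/quotW=> r; rewrite !piE; apply/germP => a * /=; rewrite scale1r. Qed.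

Fact germ_scaleDr : right_distributive germZ +%R.
Proof.
move=> c; elim/quotW=> r; elim/quotW=> s; rewrite !(piE, pi_add).
by apply/germP => a * /=; rewrite scalerDr.
Qed.

Fact germ_scaleDl u : {morph germZ^~ u : c d / c + d}.
Proof.
move=> c d; elim/quotW: u => r; rewrite !(piE, pi_add).
by apply/germP => a * /=; rewrite scalerDl.
Qed.

HB.instance Definition _ := GRing.Zmodule_isLmodule.Build Phi germ
  germ_scaleA germ_scale1 germ_scaleDr germ_scaleDl.

Fact germ_mulA : associative germM.
Proof.
elim/quotW=> r; elim/quotW=> s; elim/quotW=> t; rewrite !piE.
by apply/germP => a *.
Qed.

HB.instance Definition _ := isSemigroup.Build germ germ_mulA.

Lemma pi_scale c r : c *: \pi_germ r = \pi_germ (pmapZ c r).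
Proof. exact: pi_Z. Qed.

Lemma pi_mul r s : \pi_germ r ** \pi_germ s = \pi_germ (pmapM r s).
Proof. exact: pi_M. Qed.

Definition pi_opE := (pi_add, pi_scale, pi_mul).

Fact germ_mulDl (u v w : germ) : (u + v)%R ** w = u ** w + v ** w.
Proof.
elim/quotW: u => r; elim/quotW: v => s; elim/quotW: w => t.
rewrite !pi_opE.
by apply/germP => a /= [[? ?] ?] [[? ?] [? ?]]; rewrite pfunD.
Qed.

Fact germ_mulDr (u v w : germ) : u ** (v + w)%R = u ** v + u ** w.
Proof.
elim/quotW: u => r; elim/quotW: v => s; elim/quotW: w => t.
by rewrite !pi_opE; apply/germP.
Qed.

Fact germ_scaleAl c (u v : germ) : c *: (u ** v) = (c *: u)%R ** v.
Proof.
elim/quotW: u => r; elim/quotW: v => s; rewrite !pi_opE.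
by apply/germP => a /= [? ?] [? ?]; rewrite pfunZ.
Qed.

Fact germ_scaleAr c (u v : germ) : c *: (u ** v) = u ** (c *: v)%R.
Proof.
elim/quotW: u => r; elim/quotW: v => s; rewrite !pi_opE.
by apply/germP.
Qed.

HB.instance Definition _ := isNuAlgebra.Build Phi germ
  germ_mulDl germ_mulDr germ_scaleAl germ_scaleAr.

Definition germ_of (a : A) : germ := \pi_germ (pmap_of a).

Fact germ_of_linear : linear germ_of.
Proof.
move=> c a b; rewrite pi_scale pi_add.
by apply/germP => d _ _ /=; rewrite nu_mulDr nu_scaleAr.
Qed.

Fact germ_of_mul : {morph germ_of : a b / a ** b}.
Proof.
move=> a b; rewrite pi_mul.
by apply/germP => d _ _ /=; rewrite mulgA.
Qed.

HB.instance Definition _ :=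
  GRing.isLinear.Build Phi A germ *:%R germ_of germ_of_linear.
HB.instance Definition _ := isMultiplicative.Build A germ germ_of germ_of_mul.

Definition germ_hom : {nuhom A -> germ} := germ_of.

Lemma germ_of_inj : injective germ_of.
Proof.
move=> a b /germP E0; have E c : c ** a = c ** b by exact: E0.
apply: contrapT => ne.
have /rfA[c] : a - b <> 0 by move/subr0_eq.
by rewrite nu_mulBr E subrr.
Qed.

Lemma germ_ofM a r : pdom r a -> germ_of a ** \pi_germ r = germ_of (pfun r a).
Proof.
move=> ra; rewrite pi_mul.
by apply/germP => d _ _ /=; rewrite pfunM.
Qed.

Lemma germ_left_quotient : left_quotient_alg germ_hom.
Proof.
split=> [|p q]; first exact: germ_of_inj.
elim/quotW: p => r; elim/quotW: q => s rn0.
suff [a [ra sa ran0]] : exists a, [/\ pdom r a, pdom s a & pfun r a <> 0].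
  exists a; rewrite !germ_ofM //; split; last by exists (pfun s a).
  by move=> E; apply: ran0; apply: germ_of_inj; rewrite E -(raddf0 germ_hom).
apply: contrapT => no; apply: rn0; apply/eqmodP.
apply: (dense_agree (denseI (pdom_ideal r) (pdom_dense r) (pdom_dense s))).
move=> a [ra sa]; split=> //=.
by apply: contrapT => ran0; apply: no; exists a.
Qed.

End LeftQuotients.

(** * The Martindale symmetric algebra of quotients *)

Section Martindale.
Variables (Phi : comPzRingType) (A : nuAlgType Phi).
Implicit Types (a b : A) (I J K : set A).

Lemma nondegenerate_faithful : nondegenerate A -> right_faithful A.
Proof.
move=> ndA p pn0; apply: contrapT => no; apply: pn0; apply: ndA => b.
rewrite -mulgA [b ** p](_ : _ = 0) ?nu_mul0r //.
by apply: contrapT => bp; apply: no; exists b.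
Qed.

Section MartindaleTheory.
Variables (S : nuAlgType Phi) (f : {nuhom A -> S}).
Hypothesis mf : martindale_symmetric_alg f.

Lemma martindale_inj : injective f.
Proof.
move: mf => [Q [i [g [[[inj_i _] _] _ gf _]]]] a b E.
by apply: inj_i; rewrite -!gf E.
Qed.

Lemma martindale_eq0 a : f a = 0 -> a = 0.
Proof. by rewrite -(nuhom0 f) => /martindale_inj. Qed.

Lemma martindale_essential (q : S) : exists2 I, essential_ideal I &
  forall a, I a -> range f (f a ** q) /\ range f (q ** f a).
Proof.
move: mf => [Q [i [g [_ inj_g gf rg]]]].
have : range g (g q) by exists q.
rewrite rg => -[I eI Iq].
exists I => // a /Iq[[b _ bE] [c _ cE]].
split; [exists b | exists c] => //; apply: inj_g.
  by rewrite /= gf bE nuhomM gf.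
by rewrite /= gf cE nuhomM gf.
Qed.

Hypothesis ndA : nondegenerate A.

Lemma martindale_rann0 I (q : S) : essential_ideal I ->
  (forall a, I a -> f a ** q = 0) -> q = 0.
Proof.
move=> eI Iq; have [[_ _ _ IM] _] := eI.
move: mf => [Q [i [g [[[inj_i ut] _] inj_g gf _]]]].
apply: contrapT => qn0.
have /(ut _ (g q))[a [ap [c _ cE]]] : g q <> 0.
  by rewrite -(nuhom0 g) => /inj_g.
apply: ap; rewrite -cE (_ : c = 0) ?nuhom0 //.
apply: (essential_rann0 ndA eI) => b Ib; apply: inj_i.
have /Iq ba0 : I (b ** a) by case: (IM a b Ib).
rewrite nuhomM cE mulgA (_ : i b ** i a = g (f (b ** a))).
  by rewrite -nuhomM ba0 !nuhom0.
by rewrite gf nuhomM.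
Qed.

Lemma martindale_lann0 I (q : S) : essential_ideal I ->
  (forall a, I a -> q ** f a = 0) -> q = 0.
Proof.
move=> eI qI; have [J eJ Jq] := martindale_essential q.
apply: (martindale_rann0 eJ) => a /Jq[[c _ cE] _].
rewrite -cE (_ : c = 0) ?nuhom0 //.
apply: (essential_lann0 ndA eI) => b Ib; apply: martindale_inj.
by rewrite nuhomM cE -mulgA qI // nu_mul0r nuhom0.
Qed.

Lemma martindale_nondegenerate I (q : S) : essential_ideal I ->
  (forall a, I a -> q ** f a ** q = 0) -> q = 0.
Proof.
move=> eI qIq; have [J eJ Jq] := martindale_essential q.
have [[_ _ _ IM] _] := eI.
apply: (martindale_rann0 eJ) => a Ja; have [[c _ cE] _] := Jq a Ja.
rewrite -cE (_ : c = 0) ?nuhom0 //.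
apply: (essential_nondegenerate ndA eI) => b Ib; apply: martindale_inj.
rewrite !nuhomM cE -(mulgA _ q) -!mulgA (mulgA (f b)) -nuhomM (mulgA q).
by rewrite qIq ?nu_mul0r ?nuhom0 //; case: (IM a b Ib).
Qed.

Lemma martindale_sandwich (q : S) : (forall a, q ** f a ** q = 0) -> q = 0.
Proof.
by move=> q0; apply: (martindale_nondegenerate (@essential_setT _ A)) => a _.
Qed.

(** The existence half of the description of Q_s(A) by multipliers. The germ of r
    lands in Q by maximality, and in S because both of its actions map K to
    A: the last hypothesis says that left multiplication by s, which must send b
    to n, is defined on K. *)
Lemma martindale_extend K (r : A -> A) : essential_ideal K ->
  (forall a b, K a -> K b -> r (a + b) = r a + r b) ->
  (forall (c : Phi) a, K a -> r (c *: a) = c *: r a) ->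
  (forall a b, K b -> r (a ** b) = a ** r b) ->
  (forall b, K b -> exists n, forall a, K a -> r a ** b = a ** n) ->
  exists s : S, forall a, K a -> f a ** s = f (r a).
Proof.
move=> eK rD rZ rM rn; have [[K0 KD KZ KM] _] := eK.
pose rfA := nondegenerate_faithful ndA.
have idK : left_ideal K by split=> // a b /(KM a)[].
have dK : dense K.
  move=> p q pn0; apply: contrapT => no; apply: pn0.
  apply: (essential_rann0 ndA eK) => a Ka; apply: contrapT => apn0.
  by apply: no; exists a; split=> //; case: (KM q a Ka).
pose p := PartialMap idK dK rD rZ rM.
move: mf => [Q [i [g [[[inj_i ut] maxQ] inj_g gf rg]]]].
have [h [_ hi]] := maxQ _ _ (germ_left_quotient rfA).
pose q := h (\pi_(germ_alg rfA) p).
have aq a : K a -> i a ** q = i (r a).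
  by move=> Ka; rewrite -!hi -nuhomM; congr (h _); exact: (@germ_ofM _ _ rfA a p).
have [s _ sE] : range g q.
  rewrite rg; exists K => // a Ka; split; first by exists (r a); rewrite ?aq.
  (* q a and n have the same left multiples by K, hence are equal *)
  have [n nE] := rn a Ka; exists n => //; apply: subr0_eq; apply: contrapT => ne.
  have /(ut _ (i n - q ** i a))[b [bne [c _ cE]]] := ne.
  apply: bne; rewrite -cE (_ : c = 0) ?nuhom0 //.
  apply: (essential_rann0 ndA eK) => d Kd; apply: inj_i.
  have Kdb : K (d ** b) by case: (KM b d Kd).
  rewrite nuhomM cE mulgA -nuhomM nu_mulBr mulgA aq // -!nuhomM nE //.
  by rewrite subrr nuhom0.
by exists s => a Ka; apply: inj_g; rewrite nuhomM !gf sE aq.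
Qed.

(** The universal property of Q_s(A): an algebra with the two defining properties
    of Q_s(A), maximality excepted, embeds in it over A. *)
Lemma martindale_embed (B : nuAlgType Phi) (k : {nuhom A -> B}) :
  left_quotient_alg k ->
  (forall b : B, exists2 I, essential_ideal I &
    forall a, I a -> range k (k a ** b) /\ range k (b ** k a)) ->
  exists h : {nuhom B -> S}, injective h /\ forall a, h (k a) = f a.
Proof.
move=> lqk kI; move: mf => [Q [i [g [[_ maxQ] inj_g gf rg]]]].
have [h0 [inj_h0 h0k]] := maxQ _ _ lqk.
have /choice[h hE] (b : B) : exists s, g s = h0 b.
  have [I eI Ib] := kI b.
  suff [s _ <-] : range g (h0 b) by exists s.
  rewrite rg; exists I => // a /Ib[[c _ cE] [d _ dE]].
  by rewrite -!h0k -!nuhomM -cE -dE; split; [exists c | exists d]; rewrite ?h0k.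
have [||F FE] := @nuhom_ex _ _ _ h.
- by move=> c u v; apply: inj_g; rewrite hE !(nuhomD, nuhomZ) !hE.
- by move=> u v; apply: inj_g; rewrite nuhomM !hE nuhomM.
exists F; split=> [u v|a]; first by rewrite !FE => E; apply: inj_h0; rewrite -!hE E.
by apply: inj_g; rewrite FE hE gf h0k.
Qed.

End MartindaleTheory.

(** The identity of A is a multiplier defined on all of A. *)
Lemma martindale_left_unit (S : nuAlgType Phi) (f : {nuhom A -> S}) :
  martindale_symmetric_alg f -> nondegenerate A ->
  exists e : S, forall t, e ** t = t.
Proof.
move=> mf ndA.
have [||||| e eE] := @martindale_extend _ _ mf ndA setT id => //.
- exact: essential_setT.
- by move=> b _; exists b.
exists e => t; apply: subr0_eq; apply: (martindale_rann0 mf ndA (@essential_setT _ A)).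
by move=> a _; rewrite nu_mulBr mulgA eE // subrr.
Qed.

End Martindale.

(** * Local algebras *)

Section LocalTheory.
Variables (Phi : comPzRingType) (A B : nuAlgType Phi) (f : {nuhom A -> B}).
Variables (x : B) (fx : absorbed f x).
Local Notation Ax := (local_alg fx).
Implicit Types (u v : Ax) (a b : A).

Lemma absorbed_left a : exists c, f c = x ** f a.
Proof. by have [[c _ cE] _] := fx a; exists c. Qed.

Lemma absorbed_right a : exists c, f c = f a ** x.
Proof. by have [_ [c _ cE]] := fx a; exists c. Qed.

Lemma local_val_inj : injective (@local_val _ _ _ _ _ fx).
Proof. exact: (@val_inj _ _ Ax). Qed.

Lemma local_val0 : local_val (0 : Ax) = 0.
Proof. exact: (raddf0 (val : Ax -> B)). Qed.

Lemma local_eltP u : exists a, u = local_elt fx a.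
Proof. by have [a uE] := local_valE u; exists a; apply: local_val_inj. Qed.

Lemma local_elt_mulE a u : local_val (local_elt fx a ** u) = x ** f a ** local_val u.
Proof. exact: local_mull. Qed.

Lemma local_mul_eltE a u : local_val (u ** local_elt fx a) = local_val u ** f a ** x.
Proof. by rewrite -mulgA; apply: local_mulr; rewrite /= mulgA. Qed.

Lemma local_val_image u : exists a, f a = local_val u.
Proof.
have [a ->] := local_valE u; have [b <-] := absorbed_left a.
by have [c <-] := absorbed_right b; exists c.
Qed.

(** The reason why nondegeneracy passes from A to its local algebras. *)
Lemma local_sandwich u a :
  local_val (u ** local_elt fx a ** u) = local_val u ** f a ** local_val u.
Proof.
have [b ->] := local_eltP u; have uE : local_val (local_elt fx b) = x ** (f b ** x).
  by rewrite /= mulgA.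
by rewrite [LHS](local_mulr _ uE) local_mul_eltE uE !mulgA.
Qed.

Lemma local_ideal (I : set A) : nu_ideal I ->
  nu_ideal [set u : Ax | exists2 a, I a & u = local_elt fx a].
Proof.
move=> [I0 ID IZ IM]; split=> /=.
- exists 0 => //; apply: local_val_inj.
  by rewrite local_val0 /= nuhom0 nu_mul0r nu_mul0l.
- move=> _ _ [a Ia ->] [b Ib ->]; exists (a + b); first exact: ID.
  by apply: local_val_inj; rewrite local_valD /= nuhomD nu_mulDr nu_mulDl.
- move=> c _ [a Ia ->]; exists (c *: a); first exact: IZ.
  by apply: local_val_inj; rewrite local_valZ /= nuhomZ -nu_scaleAr -nu_scaleAl.
move=> u _ [b Ib ->]; have [a ->] := local_eltP u; split.
  have [c cE] := absorbed_right a.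
  exists (c ** b); first by case: (IM c b Ib).
  by apply: local_val_inj; rewrite local_mulE /= nuhomM cE !mulgA.
have [c cE] := absorbed_left a.
exists (b ** c); first by case: (IM c b Ib).
by apply: local_val_inj; rewrite local_mulE /= nuhomM cE !mulgA.
Qed.

(** An inner inverse of x turns the product of the local algebra into a formula
    that no longer mentions coefficients. *)
Lemma local_regular_mulE u v y : x = x ** y ** x ->
  local_val (u ** v) = local_val u ** y ** local_val v.
Proof.
move=> xyx; have [a ->] := local_eltP u; have [b ->] := local_eltP v.
rewrite local_mulE /= !mulgA -(mulgA (x ** f a) x y).
by rewrite -(mulgA (x ** f a) (x ** y) x) -xyx.
Qed.

End LocalTheory.

Section LocalMartindale.
Variables (Phi : comPzRingType) (A S : nuAlgType Phi) (f : {nuhom A -> S}).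
Variables (x : S) (fx : absorbed f x).
Hypotheses (ndA : nondegenerate A) (mf : martindale_symmetric_alg f).
Local Notation Ax := (local_alg fx).
Local Notation Sx := (local_alg (absorbed_id x)).

Lemma local_nondegenerate : nondegenerate Ax.
Proof.
move=> u u0; apply: local_val_inj; rewrite local_val0.
apply: (martindale_sandwich mf ndA) => a.
by rewrite -local_sandwich u0 local_val0.
Qed.

Lemma local_inclusion_ex :
  exists k : {nuhom Ax -> Sx}, forall u, local_val (k u) = local_val u.
Proof.
pose k (u : Ax) : Sx := local_elt (absorbed_id x) (f (local_coef u)).
have kE u : local_val (k u) = local_val u by rewrite [RHS]local_coefK.
have [||K KE] := @nuhom_ex _ _ _ k.
- move=> c u v; apply: local_val_inj.
  by rewrite local_valD local_valZ !kE local_valD local_valZ.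
- move=> u v; apply: local_val_inj; rewrite kE.
  by rewrite (local_mull v (local_coefK u)) local_elt_mulE kE.
by exists K => u; rewrite KE kE.
Qed.

Variables (k : {nuhom Ax -> Sx}) (kE : forall u, local_val (k u) = local_val u).

(** For p = xsx and I absorbing xt on the right, xaxtx lies in A_x for a in I; if
    all xap vanished, then pap = xs(xap) = 0 for a in I would force p = 0. *)
Lemma local_left_quotient : left_quotient_alg k.
Proof.
split=> [u v E|p q pn0].
  by apply: local_val_inj; rewrite -!kE E.
have [s pE] := local_eltP p; have [t qE] := local_eltP q.
have [I eI Ixt] := martindale_essential mf (x ** t).
apply: contrapT => no; apply: pn0; apply: local_val_inj; rewrite local_val0.
apply: (martindale_nondegenerate mf ndA eI) => a Ia.
suff ap0 : x ** f a ** local_val p = 0.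
  by rewrite {1}pE /= -(mulgA (x ** _) x) -(mulgA (x ** _)) ap0 nu_mul0r.
have kuM w : local_val (k (local_elt fx a) ** w) = x ** f a ** local_val w.
  by apply: local_mull; rewrite kE.
rewrite -kuM; apply: contrapT => ap; apply: no; exists (local_elt fx a).
split; first by move=> E; apply: ap; rewrite E local_val0.
have [[c _ cE] _] := Ixt a Ia; exists (local_elt fx c) => //.
apply: local_val_inj; rewrite kuM kE qE /= cE.
by rewrite !mulgA.
Qed.

(** For w = xsx take xLx, where L is an essential ideal of A absorbing xs and sx. It
    meets every nonzero ideal K of A_x: for u = xax in K, the products
    u(xbx)u = x(axbxa)x with b in L lie in both and do not all vanish. *)
Lemma local_essential (w : Sx) : exists2 I, essential_ideal I &
  forall u, I u -> range k (k u ** w) /\ range k (w ** k u).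
Proof.
have [s wE] := local_eltP w.
have [I eI Ixs] := martindale_essential mf (x ** s).
have [J eJ Jsx] := martindale_essential mf (s ** x).
have eL := essential_idealI eI eJ; set L := I `&` J in eL.
have [[_ _ _ LM] _] := eL.
exists [set u | exists2 a, L a & u = local_elt fx a].
  apply: essentialP => [|K u idK Ku un0].
    exact: (local_ideal fx eL.1).
  have [b Lb ubu] : exists2 b, L b & u ** local_elt fx b ** u <> 0.
    apply: contrapT => no; apply: un0; apply: local_val_inj; rewrite local_val0.
    apply: (martindale_nondegenerate mf ndA eL) => b Lb; rewrite -local_sandwich.
    rewrite -(local_val0 fx); congr local_val.
    by apply: contrapT => ubu; apply: no; exists b.
  exists (u ** local_elt fx b ** u) => //; split.
    have [a uE] := local_eltP u.
    have [c cE] := absorbed_right fx a; have [d dE] := absorbed_left fx a.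
    exists (c ** b ** d); first by case: (LM d (c ** b)) => //; case: (LM c b Lb).
    apply: local_val_inj; rewrite local_sandwich uE /= !nuhomM cE dE.
    by rewrite !mulgA.
  by case: idK => _ _ _ /(_ (u ** local_elt fx b) u Ku)[].
move=> _ [a [Ia Ja] ->]; have [[c _ cE] _] := Ixs a Ia; have [_ [d _ dE]] := Jsx a Ja.
split; [exists (local_elt fx c) | exists (local_elt fx d)] => //.
  apply: local_val_inj; rewrite kE wE local_mul_eltE kE /= cE.
  by rewrite !mulgA.
apply: local_val_inj; rewrite kE wE local_elt_mulE kE /= dE.
by rewrite !mulgA.
Qed.

End LocalMartindale.

(** * Lifting an element of the quotients of the local algebra *)

Section RegularExtension.
Variables (Phi : comPzRingType) (A S : nuAlgType Phi) (f : {nuhom A -> S}).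
Variables (x : S) (fx : absorbed f x).
Hypotheses (ndA : nondegenerate A) (mf : martindale_symmetric_alg f).
Local Notation Ax := (local_alg fx).
Local Notation Sx := (local_alg (absorbed_id x)).

Variables (y : S) (xyx : x = x ** y ** x).

Lemma regular_valr (u : Ax) : local_val u ** y ** x = local_val u.
Proof.
have [a ->] := local_eltP u; rewrite /= -(mulgA (x ** f a)) -(mulgA (x ** f a)).
by rewrite -xyx.
Qed.

Lemma regular_vall (u : Ax) : x ** y ** local_val u = local_val u.
Proof. by have [a ->] := local_eltP u; rewrite /= !mulgA -xyx. Qed.

(** For q in Q_s(A_x), the maps r and l stand for u |-> uq and v |-> qv on I. Only
    the balance between them enters the construction. *)
Variables (L : set A) (eL : essential_ideal L).
Hypothesis Ly : forall a, L a -> range f (f a ** y) /\ range f (y ** f a).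

Variables (I : set Ax) (eI : essential_ideal I) (r l : Ax -> Ax).
Hypothesis rl : forall u v, I u -> I v -> r u ** v = u ** l v.

(** The formal relation ks = m for s = yqy: such an s satisfies s = sxy, and
    sv = yqv in S for v in I. *)
Definition right_value (k m : A) : Prop := f m ** x ** y = f m /\
  forall v, I v -> f m ** local_val v = f k ** y ** local_val (l v).

(** The formal relation sb = n, expressed by testing it against the right action of
    s, so that the two actions are balanced by construction. *)
Definition left_value (b n : A) : Prop :=
  forall k m, right_value k m -> m ** b = k ** n.

(** The relations are closed under multiplication by A on one side each; closing
    the domain on the other side makes it a two-sided ideal. *)
Definition extension_domain : set A := [set k |
  [/\ exists m, right_value k m,
      forall b, exists m, right_value (k ** b) m,
      exists n, left_value k n
    & forall a, exists n, left_value (a ** k) n]].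

Lemma right_value0 : right_value 0 0.
Proof. by split=> [|v _]; rewrite nuhom0 !nu_mul0l. Qed.

Lemma right_valueD k m k' m' : right_value k m -> right_value k' m' ->
  right_value (k + k') (m + m').
Proof.
move=> [mE mI] [mE' mI']; split=> [|v Iv]; rewrite !nuhomD !nu_mulDl.
  by rewrite mE mE'.
by rewrite mI ?mI'.
Qed.

Lemma right_valueZ c k m : right_value k m -> right_value (c *: k) (c *: m).
Proof.
move=> [mE mI]; split=> [|v Iv]; rewrite !nuhomZ -!nu_scaleAl.
  by rewrite mE.
by rewrite mI.
Qed.

Lemma right_valueM a k m : right_value k m -> right_value (a ** k) (a ** m).
Proof.
move=> [mE mI]; split=> [|v Iv]; rewrite !nuhomM -!mulgA.
  by rewrite (mulgA _ x) mE.
by rewrite mI ?mulgA.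
Qed.

(** Both parts of [right_value] matter here: the test against I shows that xAdx
    is zero in A_x, so dx = 0, and then d = (dx)y = 0. *)
Lemma right_value_inj k m m' : right_value k m -> right_value k m' -> m = m'.
Proof.
move=> [mE mI] [mE' mI']; apply: subr0_eq; set d := m - m'.
have dE : f d ** x ** y = f d by rewrite nuhomB !nu_mulBl mE mE'.
have dI v : I v -> f d ** local_val v = 0.
  by move=> Iv; rewrite nuhomB nu_mulBl mI ?mI' ?subrr.
apply: (martindale_eq0 mf); rewrite -dE [f d ** x](_ : _ = 0) ?nu_mul0l //.
apply: (martindale_sandwich mf ndA) => a.
rewrite -(mulgA _ x) -(mulgA (f d)) [X in _ ** X](_ : _ = 0) ?nu_mul0r //.
have [w wE] : exists w : Ax, local_val w = x ** (f a ** f d ** x).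
  by exists (local_elt fx (a ** d)); rewrite /= nuhomM !mulgA.
rewrite -(mulgA x) (mulgA (f a)) -wE [w](_ : _ = 0) ?local_val0 //.
apply: (essential_lann0 (local_nondegenerate ndA mf) eI) => v Iv.
apply: local_val_inj; rewrite local_val0 (local_regular_mulE _ _ xyx) wE.
rewrite !mulgA -(mulgA (x ** f a)) -(mulgA (x ** f a)) dE.
by rewrite -(mulgA (x ** f a)) dI ?nu_mul0r.
Qed.

Lemma left_valueZ c b n : left_value b n -> left_value (c *: b) (c *: n).
Proof. by move=> bn k m /bn E; rewrite -!nu_scaleAr E. Qed.

Lemma left_valueD b n b' n' : left_value b n -> left_value b' n' ->
  left_value (b + b') (n + n').
Proof. by move=> bn bn' k m km; rewrite !nu_mulDr (bn _ _ km) (bn' _ _ km). Qed.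

Lemma left_valueM b n a : left_value b n -> left_value (b ** a) (n ** a).
Proof. by move=> bn k m km; rewrite !mulgA (bn _ _ km). Qed.

Lemma left_value0 : left_value 0 0.
Proof. by move=> k m _; rewrite !nu_mul0r. Qed.

Lemma extension_domain_ideal : nu_ideal extension_domain.
Proof.
split.
- split=> [|b||a]; first by exists 0; exact: right_value0.
  + by exists 0; rewrite nu_mul0l; exact: right_value0.
  + by exists 0; exact: left_value0.
  by exists 0; rewrite nu_mul0r; exact: left_value0.
- move=> k k' [[m km] kb [n kn] ka] [[m' km'] kb' [n' kn'] ka']; split.
  + by exists (m + m'); exact: right_valueD.
  + move=> b; have [c bc] := kb b; have [c' bc'] := kb' b.
    by exists (c + c'); rewrite nu_mulDl; exact: right_valueD.
  + by exists (n + n'); exact: left_valueD.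
  move=> a; have [c ac] := ka a; have [c' ac'] := ka' a.
  by exists (c + c'); rewrite nu_mulDr; exact: left_valueD.
- move=> c k [[m km] kb [n kn] ka]; split.
  + by exists (c *: m); exact: right_valueZ.
  + move=> b; have [d bd] := kb b.
    by exists (c *: d); rewrite -nu_scaleAl; exact: right_valueZ.
  + by exists (c *: n); exact: left_valueZ.
  move=> a; have [d ad] := ka a.
  by exists (c *: d); rewrite -nu_scaleAr; exact: left_valueZ.
move=> a k [[m km] kb [n kn] ka]; split; split.
- by exists (a ** m); exact: right_valueM.
- move=> b; have [d bd] := kb b.
  by exists (a ** d); rewrite -mulgA; exact: right_valueM.
- exact: ka.
- by move=> b; have := ka (b ** a); rewrite mulgA.
- exact: kb.
- by move=> b; have := kb (a ** b); rewrite mulgA.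
- by exists (n ** a); exact: left_valueM.
by move=> b; have [d bd] := ka b; exists (d ** a); rewrite mulgA; exact: left_valueM.
Qed.

(** Multiplying bzb' by elements of A keeps its shape, so it suffices to compute the
    action of s on elements of this shape. *)
Lemma extension_domain_sandwich z :
  (forall b b', L b -> L b' -> exists m, right_value (b ** z ** b') m) ->
  (forall b b', L b -> L b' -> exists n, left_value (b ** z ** b') n) ->
  forall b b', L b -> L b' -> extension_domain (b ** z ** b').
Proof.
move=> zm zn b b' Lb Lb'; have [[_ _ _ LM] _] := eL.
split=> [|c||a]; first exact: zm; [|exact: zn|].
  by rewrite -mulgA; apply: zm => //; case: (LM c b' Lb').
by rewrite !mulgA; apply: zn => //; case: (LM a b Lb).
Qed.

(** With u in I, the actions of s = yqy are (b u b')s = b r(u b'yx) y and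
    s(b u b') = y l(xyb u) b'; the outer factors in L bring y into A. *)
Lemma extension_domain_image u z b b' : I u -> f z = local_val u -> L b -> L b' ->
  extension_domain (b ** z ** b').
Proof.
move=> Iu zE Lb Lb'; have [[_ _ _ IM] _] := eI; have [[_ _ _ LM] _] := eL.
apply: extension_domain_sandwich b b' Lb Lb' => b b' Lb Lb'.
  have [[c _ cE] _] := Ly Lb'.
  pose w := u ** local_elt fx c.
  have Iw : I w by case: (IM (local_elt fx c) u Iu).
  have wE : local_val w = local_val u ** f b' ** y ** x.
    by rewrite local_mul_eltE cE mulgA.
  have [t tE] := local_val_image (r w).
  have Lbt : L (b ** t) by case: (LM t b Lb).
  have [[m _ mE] _] := Ly Lbt; exists m; rewrite nuhomM tE in mE; split=> [|v Iv].
    by rewrite mE -(mulgA (f b)) -(mulgA (f b)) -(mulgA (f b)) regular_valr.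
  rewrite mE !nuhomM zE -(mulgA (f b)) -(mulgA (f b)) -(local_regular_mulE _ _ xyx).
  rewrite rl // (local_regular_mulE _ _ xyx) wE.
  by rewrite !mulgA -(mulgA _ x y) -(mulgA _ (x ** y)) regular_vall.
have [_ [c _ cE]] := Ly Lb.
pose v := local_elt fx c ** u.
have Iv : I v by case: (IM (local_elt fx c) u Iu).
have vE : local_val v = x ** y ** f b ** local_val u.
  by rewrite local_elt_mulE cE mulgA.
have [t tE] := local_val_image (l v).
have Ltb : L (t ** b') by case: (LM t b' Lb').
have [_ [n _ nE]] := Ly Ltb; exists n => k m [mE mI].
apply: (martindale_inj mf); rewrite !nuhomM zE nE nuhomM tE !mulgA -mI // vE.
by rewrite !mulgA mE.
Qed.

(** Both actions of s = yqy vanish here, q being formally an element of xSx: zb'y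
    lies in J, so zb'yx = 0, and likewise xybz = 0. *)
Lemma extension_domain_orthogonal (J : set A) z b b' : nu_ideal J ->
  (forall a, J a -> x ** f a = 0) -> (forall a, J a -> f a ** x = 0) ->
  J z -> L b -> L b' -> extension_domain (b ** z ** b').
Proof.
move=> [_ _ _ JM] xJ Jx Jz; move: b b'.
apply: extension_domain_sandwich => b b' Lb Lb'.
  have [[c _ cE] _] := Ly Lb'; exists 0; split=> [|v Iv]; rewrite nuhom0 !nu_mul0l //.
  have [a ->] := local_eltP (l v).
  have /Jx zcx : J (z ** c) by case: (JM c z Jz).
  rewrite nuhomM cE in zcx.
  rewrite !nuhomM /= !mulgA -(mulgA (f b ** f z)) -(mulgA (f b)) -(mulgA (f b)) zcx.
  by rewrite !(nu_mul0r, nu_mul0l).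
have [_ [c _ cE]] := Ly Lb; exists 0 => k m [mE _].
have /xJ xcz : J (c ** z) by case: (JM c z Jz).
rewrite nu_mul0r; apply: (martindale_inj mf).
rewrite !nuhomM -mE nuhom0.
rewrite nuhomM cE in xcz.
have -> : f m ** x ** y ** (f b ** f z ** f b') =
  f m ** (x ** (y ** f b ** f z)) ** f b' by rewrite !mulgA.
by rewrite xcz !(nu_mul0r, nu_mul0l).
Qed.

(** A nonzero ideal J either has xJx nonzero, and this ideal of A_x meets I, or has
    xJx = 0, which by nondegeneracy means xJ = Jx = 0. Either way some LzL inside
    J is nonzero and lies in the domain. *)
Lemma extension_domain_essential : essential_ideal extension_domain.
Proof.
apply: essentialP => [|J a idJ Ja an0]; first exact: extension_domain_ideal.
have [_ _ _ JM] := idJ.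
have sandwich0 z : z <> 0 -> exists b b', [/\ L b, L b' & b ** z ** b' <> 0].
  move=> zn0; apply: contrapT => no; apply: zn0.
  apply: (essential_rann0 ndA eL) => b Lb.
  apply: (essential_lann0 ndA eL) => b' Lb'.
  by apply: contrapT => bzb'; apply: no; exists b, b'.
have [xJx|] := pselect (forall z, J z -> x ** f z ** x = 0).
  have xJ z : J z -> x ** f z = 0.
    move=> Jz; apply: (martindale_sandwich mf ndA) => d; rewrite mulgA.
    have /xJx : J (z ** d) by case: (JM d z Jz).
    by rewrite nuhomM mulgA => ->; rewrite nu_mul0l.
  have Jx z : J z -> f z ** x = 0.
    move=> Jz; apply: (martindale_sandwich mf ndA) => d.
    have /xJx : J (d ** z) by case: (JM d z Jz).
    by rewrite nuhomM -!mulgA => ->; rewrite nu_mul0r.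
  have [b [b' [Lb Lb' bab']]] := sandwich0 a an0.
  exists (b ** a ** b') => //; split; first exact: (extension_domain_orthogonal idJ).
  by case: (JM b' (b ** a)) => //; case: (JM b a).
move=> /existsNP[z0 /not_implyP[Jz0 xz0x]].
pose J' := [set u : Ax | exists2 z, J z & u = local_elt fx z].
have idJ' : nu_ideal J'.
  have [J0 JD JZ _] := idJ.
  exact: (local_ideal fx idJ).
have [|u [Iu [z Jz uE]] un0] := essential_meet eI idJ'.
  exists (local_elt fx z0); first by exists z0.
  by move=> /(congr1 (@local_val _ _ _ _ _ fx)); rewrite local_val0.
rewrite {}uE in Iu un0.
have [z' z'E] := local_val_image (local_elt fx z).
have [|b [b' [Lb Lb' bzb']]] := sandwich0 z'.
  move=> z'0; apply: un0; apply: local_val_inj.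
  by rewrite -z'E z'0 nuhom0 local_val0.
exists (b ** z' ** b') => //; split; first exact: (extension_domain_image Iu).
(* z' is xzx, so the outer factors are needed to return to J *)
have [c cE] := absorbed_right fx b; have [d dE] := absorbed_left fx b'.
rewrite (_ : b ** z' ** b' = c ** z ** d).
  by case: (JM d (c ** z)) => //; case: (JM c z).
by apply: (martindale_inj mf); rewrite !nuhomM z'E cE dE /= !mulgA.
Qed.

(** The identity usv = u(qv), which determines xsx as an element of Q_s(A_x) since
    elements there are determined by two-sided products with I. *)
Lemma regular_extension :
  exists s : S, forall u v, I u -> I v ->
    local_val u ** s ** local_val v = local_val (u ** l v).
Proof.
have eK := extension_domain_essential; have [[_ _ _ KM] _] := eK.
have [r' r'P] : exists r', forall k, extension_domain k -> right_value k (r' k).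
  have /choice[r' r'P] k : exists m, extension_domain k -> right_value k m.
    have [[[m km] _ _ _]|no] := pselect (extension_domain k); first by exists m.
    by exists 0 => /no.
  by exists r'.
have r'E k m : extension_domain k -> right_value k m -> r' k = m.
  by move=> Kk km; apply: right_value_inj km; exact: r'P.
have [||||s sE] := martindale_extend mf ndA (r := r') eK.
- move=> a b Ka Kb; apply: r'E; last by apply: right_valueD; exact: r'P.
  by case: eK => -[_ KD _ _] _; exact: KD.
- move=> c a Ka; apply: r'E; last by apply: right_valueZ; exact: r'P.
  by case: eK => -[_ _ KZ _] _; exact: KZ.
- move=> a b Kb; apply: r'E; last by apply: right_valueM; exact: r'P.
  by case: (KM a b Kb).
- by move=> b [_ _ [n bn] _]; exists n => a /r'P /bn.
exists s => u v Iu Iv; apply: subr0_eq.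
apply: (martindale_rann0 mf ndA eK) => k Kk.
have [a aE] := local_val_image u.
have Kka : extension_domain (k ** a) by case: (KM a k Kk).
have [_ /(_ v Iv) E] := r'P _ Kka.
rewrite nu_mulBr (local_regular_mulE _ _ xyx) -aE !mulgA -nuhomM sE // E.
by rewrite nuhomM subrr.
Qed.

End RegularExtension.

(** * The theorem *)

Theorem theorem2p5 (Phi : comPzRingType) (A S : nuAlgType Phi)
    (f : {nuhom A -> S}) (x : S) (fx : absorbed f x)
    (T : nuAlgType Phi) (j : {nuhom local_alg fx -> T}) :
  semiprime A ->
  martindale_symmetric_alg f ->
  martindale_symmetric_alg j ->
  vn_regular x <->
  exists phi : {nuhom T -> local_alg (absorbed_id x)},
    bijective phi /\ forall u : local_alg fx, local_val (phi (j u)) = local_val u.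
Proof.
move=> /semiprime_nondegenerate ndA mf mj.
have ndAx := local_nondegenerate (fx := fx) ndA mf.
split=> [[y xyx]|[phi [[psi phiK psiK] _]]]; last first.
  have [e eT] := martindale_left_unit mj ndAx.
  have [s sE] := local_eltP (phi e).
  exists s; apply/esym/subr0_eq/(martindale_sandwich mf ndA) => a.
  have xsx t : (x ** s ** x - x) ** t ** x = 0.
    rewrite !nu_mulBl; apply/eqP; rewrite subr_eq0; apply/eqP.
    have := congr1 phi (eT (psi (local_elt (absorbed_id x) t))).
    rewrite nuhomM psiK sE => /(congr1 (@local_val _ _ _ _ _ (absorbed_id x))).
    by rewrite local_mulE.
  by rewrite nu_mulBr !mulgA xsx !nu_mul0l subrr.
have [k kE] := local_inclusion_ex fx.
have [h [inj_h hk]] := martindale_embed mj (local_left_quotient ndA mf kE)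
  (local_essential ndA mf kE).
suff /choice[psi psiK] q : exists w, h w = q.
  have [||phi phiE] := @nuhom_ex _ _ _ psi.
  - by move=> c p q; apply: inj_h; rewrite psiK nuhomD nuhomZ !psiK.
  - by move=> p q; apply: inj_h; rewrite nuhomM !psiK.
  exists phi; split.
    by exists h => [q|w]; rewrite phiE; [exact: psiK | apply: inj_h; rewrite psiK].
  move=> u; rewrite phiE -kE -hk; congr local_val.
  by apply: inj_h; rewrite psiK.
have [I eI Iq] := martindale_essential mj q.
have /choice[r rE] u : exists r, I u -> j r = j u ** q.
  have [/Iq[[r _ rE] _]|no] := pselect (I u); last by exists 0 => /no.
  by exists r.
have /choice[l lE] v : exists l, I v -> j l = q ** j v.
  have [/Iq[_ [l _ lE]]|no] := pselect (I v); last by exists 0 => /no.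
  by exists l.
have [L eL Ly] := martindale_essential mf y.
have rl u v : I u -> I v -> r u ** v = u ** l v.
  by move=> Iu Iv; apply: (martindale_inj mj); rewrite !nuhomM rE ?lE ?mulgA.
have [s sE] := regular_extension ndA mf xyx eL Ly eI rl.
pose w := local_elt (absorbed_id x) s; exists w; apply: subr0_eq.
apply: (martindale_rann0 mj ndAx eI) => u Iu.
apply: (martindale_lann0 mj ndAx eI) => v Iv.
rewrite nu_mulBr nu_mulBl -mulgA -mulgA -lE // -nuhomM -!hk -!nuhomM.
rewrite (_ : k u ** (w ** k v) = k (u ** l v)) ?subrr //.
apply: local_val_inj; rewrite !(local_regular_mulE _ _ xyx) !kE -sE //.
by rewrite /= !mulgA regular_valr // -!mulgA (mulgA x) regular_vall.
Qed.
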